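(* Let $\{G_n\}$ be a sequence of finite connected vertex transitive graphs with $|G_n|\to\infty$, such that simple random walk on each $G_n$ is aperiodic, and let $G_n^\diamondsuit=\mathbb{Z}_2\wr G_n$ with the lamplighter walk driven by simple random walk on $G_n$. Then, as $|G_n|\to\infty$, $$\frac{1}{8\log 2}\le\frac{T_{\mathrm{rel}}(G_n^\diamondsuit)}{t^*(G_n)}\le\frac{2}{\log 2}+o(1).$$
   Context: Graphs have no multiple edges; loops are allowed. $|G|$ is the number of vertices of $G$. For a finite graph $G$ with vertex set $V_G$, the lamplighter graph $G^\diamondsuit=\mathbb{Z}_2\wr G$ has vertices the pairs $(f,x)$ with $f\in\{0,1\}^{V_G}$ and $x\in V_G$. Given the transition probabilities $q(\cdot,\cdot)$ of a random walk on $G$ (here simple random walk), the lamplighter walk on $G^\diamondsuit$ has transition probabilities: for $a\ne b$, $p[(f,a),(h,b)]=q(a,b)/4$ if $f$ and $h$ agree outside $\{a,b\}$; for $a=b$, $p[(f,a),(h,a)]=q(a,a)/2$ if $f$ and $h$ agree outside $\{a\}$; all other transition probabilities are $0$. The relaxation time of a chain with transition matrix $p$ is $T_{\mathrm{rel}}=\max_{i:|\lambda_i|<1}\frac{1}{1-|\lambda_i|}$, where $\lambda_i$ are the eigenvalues of $p$; $T_{\mathrm{rel}}(G_n^\diamondsuit)$ refers to the lamplighter walk. The maximal hitting time is $t^*(G)=\max_{x,y}\mathbb{E}_xT_y$, where $T_y$ is the hitting time of $y$ by the walk on $G$. *)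

(* Defs.v *)
From HB Require Import structures.
From mathcomp Require Import all_boot all_order all_algebra all_fingroup.
From mathcomp Require Import complex.
From mathcomp Require Import all_classical all_reals all_analysis.
Import Order.TTheory GRing.Theory Num.Theory.
Import numFieldNormedType.Exports.
Set Implicit Arguments.
Unset Strict Implicit.
Unset Printing Implicit Defensive.
Local Open Scope classical_set_scope.
Local Open Scope ring_scope.

(* Since [adj] is a relation, there are no multiple edges; it need not be
   irreflexive, so loops are allowed. *)
Structure graph := Graph {
  vertex :> finType;
  adj : rel vertex;
  adj_sym : symmetric adj }.

Definition graph_connected (G : graph) : Prop :=
  (0 < #|vertex G|)%N /\ forall x y : G, connect (@adj G) x y.

Definition graph_automorphism (G : graph) (s : {perm G}) : Prop :=
  forall x y : G, adj (s x) (s y) = adj x y.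

Definition vertex_transitive (G : graph) : Prop :=
  forall x y : G, exists2 s : {perm G}, graph_automorphism s & s x = y.

(* A loop at x makes x one of its own neighbours, counted once. *)
Definition degree (G : graph) (x : G) : nat := #|[set y : G | adj x y]%SET|.

Section Chains.
Variable R : realType.

Definition srw (G : graph) (x y : G) : R :=
  if adj x y then (degree x)%:R^-1 else 0.

Section Kernel.
Variables (T : finType) (q : T -> T -> R).

Definition transition_mx : 'M[R]_#|T| :=
  \matrix_(i, j) q (enum_val i) (enum_val j).

Definition step_prob (t : nat) (x y : T) : R :=
  (transition_mx ^+ t) (enum_rank x) (enum_rank y).

(* gcd {t >= 1 | q^t(x,x) > 0} = 1 for every x; the gcd of the empty set is 0,
   so x must return to itself with positive probability. *)
Definition aperiodic : Prop :=
  forall (x : T) (d : nat),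
    (forall t : nat, (0 < t)%N -> 0 < step_prob t x x -> (d %| t)%N) -> d = 1%N.

(* The eigenvalues are the complex ones.  There are finitely many of them, so
   the supremum is a maximum. *)
Definition relaxation_time : R :=
  sup [set (1 - Normc.normc l)^-1 | l in
    [set l : R[i] | eigenvalue (map_mx (real_complex R) transition_mx) l /\
                    Normc.normc l < 1]].

(* Probability that the walk started at x follows the trajectory x :: w. *)
Fixpoint path_prob (x : T) (w : seq T) : R :=
  if w is y :: w' then q x y * path_prob y w' else 1.

(* P_x(T_y = t).  [index y (x :: w)] is the first time at which the trajectory
   x :: w is at y; it is (size w).+1 if y has not been visited. *)
Definition hitting_prob (x y : T) (t : nat) : R :=
  \sum_(w : t.-tuple T | index y (x :: w) == t) path_prob x w.

(* E_x T_y, where T_y = +oo when y is never visited; +oo * 0 = 0 in \bar R. *)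
Definition expected_hitting_time (x y : T) : \bar R :=
  (\sum_(0 <= t <oo) (t%:R * hitting_prob x y t)%:E
   + +oo * (1 - \sum_(0 <= t <oo) (hitting_prob x y t)%:E))%E.

Definition maximal_hitting_time : \bar R :=
  \big[maxe/0%E]_(x : T) \big[maxe/0%E]_(y : T) expected_hitting_time x y.

Definition lamplighter_state : finType := ({ffun T -> bool} * T)%type.

Definition lamplighter (s s' : lamplighter_state) : R :=
  let: (f, a) := s in let: (h, b) := s' in
  if a == b then
    if [forall v, (v != a) ==> (f v == h v)] then q a a / 2 else 0
  else
    if [forall v, (v != a) && (v != b) ==> (f v == h v)]
    then q a b / 4 else 0.

End Kernel.

(* T_rel(G^<>) / t*(G).  For connected G, t*(G) is finite, and it is nonzero as
   soon as G has two vertices. *)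
Definition rel_hit_ratio (G : graph) : R :=
  relaxation_time (lamplighter (@srw G)) /
  fine (maximal_hitting_time (@srw G)).

End Chains.

(* Main.v *)
Require Import Defs.
From mathcomp Require Import all_boot all_order all_algebra all_fingroup.
From mathcomp Require Import complex.
From mathcomp Require Import all_classical all_reals all_analysis.
From mathcomp Require Import ring lra.
Import Order.TTheory GRing.Theory Num.Theory.
Import numFieldNormedType.Exports.
Set Implicit Arguments.
Unset Strict Implicit.
Unset Printing Implicit Defensive.
Local Open Scope classical_set_scope.
Local Open Scope ring_scope.

(** Let [q] be the transition kernel of simple random walk on one of the
    graphs.  Vertex transitivity makes the graph regular, so [q] is symmetric
    and the uniform distribution is stationary.  Write n for the number of
    vertices, [hit q v x] for the expected time to reach [v] from [x], t* for
    the maximum of these times, and T for the relaxation time of the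
    lamplighter walk.  For every n > 1 the proof gives

      t* / 4 <= T <= 2 t*,

    and since 1/2 <= ln 2 <= 1 this implies the bounds of the theorem, with
    error term 0.

    The link between the two chains is the flip of the lamp at a vertex [v],
    which commutes with the lamplighter walk.  A function that is odd under
    this flip must vanish, after one step, wherever the walker stands at [v],
    because the lamp there has just been refreshed.  On odd functions the
    lamplighter walk therefore acts like the walk on the graph killed at [v]
    ([killed q v]), whose Green function applied to the indicator of the
    complement of [v] is [hit q v].

    Upper bound ([lamplighter_gap]).  Let phi be an eigenvector for l, where l
    may be assumed nonzero.  If phi is not invariant under the flip at some
    [v], its odd part is an eigenvector as well, and summing its modulus over
    the lamp configurations gives a nonzero u >= 0 with u(v) = 0 and
    |l| u <= q u.  Comparing u with [hit q v] at the vertex where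
    u / [hit q v] is largest gives 1 / (1 - |l|) <= t*
    ([subsolution_gap]).  If phi is invariant under all flips, it is an
    eigenvector of [q] alone, with l real ([complex_gap], [real_gap]).  A real
    eigenvector g that vanishes somewhere is handled by the same comparison.
    Otherwise, for an automorphism s and a vertex v,
    g(v) g(s x) - g(s v) g(x) vanishes at x = v and satisfies the eigenvector
    equation; so either it is an eigenvector to which the comparison applies,
    or it is zero for all s and v.  In the last case |g| is constant by
    transitivity, and then d l is an integer, where d is the degree, so that
    |l| < 1 forces 1 / (1 - |l|) <= d <= n <= 2 (n - 1) <= 2 t*.

    Lower bound ([max_hit_le_relaxation_time]).  Every eigenvalue of the walk
    killed at [v] is an eigenvalue of the lamplighter walk, hence at distance
    at least 1/T from the unit circle ([killed_eigenvalue]).  The spectral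
    theorem for the symmetric killed kernel turns this into
    \sum_x hit q v x <= T n ([sum_hit_le]).  Finally the Dirichlet form of
    [hit q x + hit q y] is nonnegative, and written out this bounds
    [hit q y x + hit q x y] by twice the sum of the two averages
    ([commute_le_mean]), that is by 4 T. *)

Local Notation "x %:C" := (real_complex _ x) : ring_scope.
Local Notation toC := (map_mx (real_complex _)).

Lemma sum_enum_val (V : nmodType) (T : finType) (F : T -> V) :
  \sum_x F x = \sum_(i < #|T|) F (enum_val i).
Proof. by rewrite (reindex (@enum_val T T)) //; apply/onW_bij/enum_val_bij. Qed.

(** * Expected hitting times of a symmetric chain *)

Section ReversibleChain.
Variables (R : realType) (T : finType) (q : T -> T -> R).
Hypothesis q_ge0 : forall x y, 0 <= q x y.
Hypothesis q_sum1 : forall x, \sum_y q x y = 1.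
Hypothesis q_sym : forall x y, q x y = q y x.
Hypothesis q_connect : forall x y, connect (fun a b => 0 < q a b) x y.

Lemma mean_le (x : T) (g : T -> R) (M : R) :
  (forall z, g z <= M) -> \sum_z q x z * g z <= M.
Proof.
move=> gM; rewrite -[leRHS]mul1r -(q_sum1 x) mulr_suml.
by apply: ler_sum => z _; apply: ler_wpM2l.
Qed.

(** Off [y] the value of g is an average over the neighbours, so the maximum of
    |g| propagates along the edges until it reaches [y], where g vanishes. *)
Lemma harmonic_off_eq0 (y : T) (g : T -> R) :
  g y = 0 -> (forall x, x != y -> g x = \sum_z q x z * g z) ->
  forall x, g x = 0.
Proof.
move=> gy0 gE x1.
have [x0 _ x0max] := @arg_maxP _ _ _ y xpredT (fun x => `|g x|) isT.
have {x0max} gM z : `|g z| <= `|g x0| by exact: x0max.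
have spread x z : x != y -> `|g x| = `|g x0| -> 0 < q x z -> `|g z| = `|g x0|.
  move=> xy gxM qxz.
  have dev_ge0 w : 0 <= q x w * (`|g x0| - `|g w|).
    by rewrite mulr_ge0 // subr_ge0.
  have dev0 : \sum_w q x w * (`|g x0| - `|g w|) = 0.
    apply/eqP; rewrite eq_le sumr_ge0 ?andbT //.
    under eq_bigr do rewrite mulrBr.
    rewrite sumrB -mulr_suml q_sum1 mul1r subr_le0 -gxM {1}gE //.
    apply: le_trans (ler_norm_sum _ _ _) _; apply: ler_sum => w _.
    by rewrite normrM ger0_norm.
  have /eqP := psumr_eq0P (fun w _ => dev_ge0 w) dev0 (i := z) isT.
  by rewrite mulf_eq0 gt_eqF //= subr_eq0 => /eqP <-.
suff gx0 : `|g x0| = 0 by apply/eqP; rewrite -normr_le0 -gx0 gM.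
have /connectP[p pth yE] := q_connect x0 y.
have walk : forall x, `|g x| = `|g x0| -> path (fun a b => 0 < q a b) x p ->
    y = last x p -> `|g x0| = 0.
  elim: p {pth yE} => [|z p IHp] x gx /=.
    by move=> _ yE; rewrite -gx -yE gy0 normr0.
  have [xy|xy] := eqVneq x y; first by rewrite -gx xy gy0 normr0.
  by move=> /andP[qxz pth] yE; apply: (IHp z) => //; exact: spread qxz.
exact: walk pth yE.
Qed.

Definition killed (y x z : T) : R := if (x == y) || (z == y) then 0 else q x z.

(** The solution of the linear system obtained by conditioning on the first
    step; [expected_hitting_timeE] identifies it with the expected hitting
    time.  The system is written for row vectors because [killed y] is
    symmetric when [q] is. *)
Definition hit (y x : T) : R :=
  ((\row_(i < #|T|) (enum_val i != y)%:R) *m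
    invmx (1%:M - transition_mx (killed y))) 0 (enum_rank x).

Lemma killed_sum (y x : T) (g : T -> R) : g y = 0 ->
  \sum_z killed y x z * g z = if x == y then 0 else \sum_z q x z * g z.
Proof.
rewrite /killed => gy0; case: ifP => _.
  by rewrite big1 // => z _; rewrite mul0r.
by apply: eq_bigr => z _ /=; case: eqP => // ->; rewrite gy0 !mulr0.
Qed.

Lemma killed_sym (y x z : T) : killed y x z = killed y z x.
Proof. by rewrite /killed orbC q_sym. Qed.

Lemma mulmx_transition (K : T -> T -> R) (v : 'rV[R]_#|T|) (x : T) :
  (forall a b, K a b = K b a) ->
  (v *m transition_mx K) 0 (enum_rank x)
  = \sum_z K x z * v 0 (enum_rank z).
Proof.
move=> Ksym; rewrite mxE [RHS]sum_enum_val; apply: eq_bigr => i _.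
by rewrite mxE enum_rankK enum_valK mulrC Ksym.
Qed.

Lemma killed_unit (y : T) : 1%:M - transition_mx (killed y) \in unitmx.
Proof.
rewrite unitmxE unitfE; apply/det0P => -[v v0 /eqP].
rewrite mulmxBr mulmx1 subr_eq0 => /eqP vE.
pose g x := v 0 (enum_rank x).
have gE x : g x = \sum_z killed y x z * g z.
  by rewrite /g {1}vE mulmx_transition //; exact: killed_sym.
have gy0 : g y = 0.
  by rewrite gE big1 // => z _; rewrite /killed eqxx mul0r.
case/eqP: v0; apply/rowP => i; rewrite mxE -(enum_valK i).
apply: (@harmonic_off_eq0 y g) => // x xy.
by rewrite gE killed_sum // (negbTE xy).
Qed.

Lemma hitP (y : T) :
  hit y y = 0 /\ forall x, x != y -> hit y x = 1 + \sum_z q x z * hit y z.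
Proof.
have hE x : hit y x = (x != y)%:R + \sum_z killed y x z * hit y z.
  rewrite -mulmx_transition; last exact: killed_sym.
  set w := _ *m invmx _.
  have : w *m (1%:M - transition_mx (killed y)) =
     \row_(i < #|T|) (enum_val i != y)%:R by rewrite /w mulmxKV ?killed_unit.
  rewrite mulmxBr mulmx1 => /(canRL (subrK _)) /rowP/(_ (enum_rank x)).
  by rewrite [in RHS]mxE [X in _ = X + _]mxE enum_rankK.
have hy0 : hit y y = 0.
  by rewrite hE eqxx add0r big1 // => z _; rewrite /killed eqxx mul0r.
by split=> // x xy; rewrite hE xy killed_sum // (negbTE xy).
Qed.

Lemma hit_target (y : T) : hit y y = 0. Proof. by case: (hitP y). Qed.

Lemma hit_step (x y : T) : x != y -> hit y x = 1 + \sum_z q x z * hit y z.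
Proof. by case: (hitP y) => _; exact. Qed.

Lemma hit_ge0 (x y : T) : 0 <= hit y x.
Proof.
have [x0 _ x0min] := @arg_minP _ _ _ y xpredT (hit y) isT.
apply: le_trans (x0min x isT).
have [->|x0y] := eqVneq x0 y; first by rewrite hit_target.
suff : 1 + hit y x0 <= hit y x0 by lra.
rewrite {2}hit_step // lerD2l -{1}[hit y x0]mul1r -(q_sum1 x0) mulr_suml.
by apply: ler_sum => z _; apply: ler_wpM2l => //; exact: x0min.
Qed.

Lemma hit_ge1 (x y : T) : x != y -> 1 <= hit y x.
Proof.
move=> xy; rewrite hit_step // lerDl sumr_ge0 // => z _.
by rewrite mulr_ge0 // hit_ge0.
Qed.

(** Off the target this is the first-step equation.  The value at the target
    follows because the uniform distribution is stationary, so that the left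
    hand side sums to 0 over x. *)
Lemma hit_laplacian (x y : T) :
  hit y x - \sum_z q x z * hit y z = 1 - #|T|%:R * (x == y)%:R.
Proof.
have off z : z != y -> hit y z - \sum_w q z w * hit y w = 1.
  by move=> zy; rewrite {1}hit_step // addrK.
have [->|xy] := eqVneq x y; last by rewrite mulr0 subr0 off.
have : \sum_x (hit y x - \sum_z q x z * hit y z) = 0.
  rewrite sumrB exchange_big /=; apply/eqP; rewrite subr_eq0; apply/eqP.
  apply: eq_bigr => z _; rewrite -mulr_suml.
  by under eq_bigr do rewrite q_sym; rewrite q_sum1 mul1r.
rewrite (bigD1 y) //= => /eqP; rewrite addr_eq0 => /eqP ->.
rewrite (eq_bigr _ off) sumr_const (cardD1 y predT) inE add1n mulr1 -natr1.
rewrite opprD addrCA subrr addr0.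
by congr (- (_ *+ _)); apply: eq_card => z; rewrite !inE andbT.
Qed.

Lemma mean_hit_target (y : T) : \sum_z q y z * hit y z = #|T|%:R - 1.
Proof.
have := hit_laplacian y y; rewrite eqxx mulr1 hit_target sub0r.
by move/eqP; rewrite eqr_oppLR opprB => /eqP.
Qed.

Lemma card_le_hit (H : R) (y : T) : (forall x, hit y x <= H) -> #|T|%:R - 1 <= H.
Proof. by move=> hH; rewrite -(mean_hit_target y); exact: mean_le. Qed.

(** The Dirichlet form of a symmetric kernel is a sum of squares. *)
Lemma energy_ge0 (u : T -> R) : 0 <= \sum_x u x * (u x - \sum_z q x z * u z).
Proof.
have uE x : u x * (u x - \sum_z q x z * u z)
    = \sum_z q x z * (u x * (u x - u z)).
  rewrite -{2}[u x]mul1r -(q_sum1 x) mulr_suml -sumrB mulr_sumr.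
  by apply: eq_bigr => z _; ring.
rewrite (eq_bigr _ (fun x _ => uE x)).
set E := \sum_x _.
have EE : E = \sum_x \sum_z q x z * (u z * (u z - u x)).
  rewrite /E exchange_big /=; apply: eq_bigr => x _; apply: eq_bigr => z _.
  by rewrite q_sym.
suff : 0 <= E + E by lra.
rewrite {2}EE -big_split /= sumr_ge0 // => x _.
rewrite -big_split /= sumr_ge0 // => z _.
have -> : q x z * (u x * (u x - u z)) + q x z * (u z * (u z - u x))
    = q x z * (u x - u z) ^+ 2 by ring.
by rewrite mulr_ge0 // sqr_ge0.
Qed.

(** By [hit_laplacian], the energy of u = [hit x + hit y] is
    2 \sum_z u(z) - n u(x) - n u(y), and it is nonnegative. *)
Lemma commute_le_mean (x y : T) :
  #|T|%:R * (hit y x + hit x y) <= 2 * (\sum_z hit x z + \sum_z hit y z).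
Proof.
have := energy_ge0 (fun z => hit x z + hit y z).
have uE z : (hit x z + hit y z) *
     ((hit x z + hit y z) - \sum_w q z w * (hit x w + hit y w))
  = 2 * (hit x z + hit y z) - (if z == x then #|T|%:R * hit y x else 0)
     - (if z == y then #|T|%:R * hit x y else 0).
  have -> : \sum_w q z w * (hit x w + hit y w)
      = \sum_w q z w * hit x w + \sum_w q z w * hit y w.
    by rewrite -big_split; apply: eq_bigr => w _; rewrite mulrDr.
  have -> : hit x z + hit y z - (\sum_w q z w * hit x w + \sum_w q z w * hit y w)
     = (1 - #|T|%:R * (z == x)%:R) + (1 - #|T|%:R * (z == y)%:R).
    by rewrite -!hit_laplacian; ring.
  case: eqP => [->|_]; case: eqP => [->|_] /=; rewrite ?hit_target; ring.
rewrite (eq_bigr _ (fun z _ => uE z)) !sumrB -!big_mkcond /= !big_pred1_eq.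
rewrite -mulr_sumr big_split /=; lra.
Qed.

(** A maximum principle: [hit v] is a strict supersolution of the walk killed
    at [v], so a subsolution for the factor [r] is compared with it at the
    point where their ratio is largest. *)
Lemma subsolution_gap (v : T) (u : T -> R) (r H : R) :
  (forall x, 0 <= u x) -> u v = 0 -> (exists x, u x != 0) ->
  (forall x, r * u x <= \sum_z q x z * u z) -> (forall x, hit v x <= H) ->
  1 <= (1 - r) * H.
Proof.
move=> u_ge0 uv0 [x1 ux1] usub hH.
have x1v : x1 != v by apply: contraNneq ux1 => ->; rewrite uv0.
have hpos x : x != v -> 0 < hit v x by move/hit_ge1/(lt_le_trans ltr01).
have [x0 x0v x0max] :=
  @arg_maxP _ _ _ x1 (fun x => x != v) (fun x => u x / hit v x) x1v.
set c := u x0 / hit v x0 in x0max.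
have uc z : u z <= c * hit v z.
  have [->|zv] := eqVneq z v; first by rewrite uv0 hit_target mulr0.
  by rewrite -ler_pdivrMr ?hpos //; exact: x0max.
have c_gt0 : 0 < c.
  apply: lt_le_trans (x0max _ x1v).
  by rewrite divr_gt0 ?hpos // lt_neqAle eq_sym ux1 u_ge0.
have ux0 : u x0 = c * hit v x0 by rewrite /c divfK // gt_eqF // hpos.
have : r * hit v x0 <= hit v x0 - 1.
  rewrite -(ler_pM2l c_gt0) mulrCA -ux0; apply: le_trans (usub x0) _.
  rewrite hit_step // [1 + _]addrC addrK mulr_sumr; apply: ler_sum => z _.
  by rewrite mulrCA; apply: ler_wpM2l.
have h1 := hit_ge1 x0v; have hH0 := hH x0 => rh.
have r1 : 0 < 1 - r by rewrite -(pmulr_lgt0 _ (hpos _ x0v)); lra.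
apply: le_trans (_ : (1 - r) * hit v x0 <= _); first by lra.
by rewrite ler_pM2l.
Qed.

End ReversibleChain.

Lemma big_tuple_cons (V : nmodType) (T : finType) (t : nat)
    (P : pred (seq T)) (F : seq T -> V) :
  \sum_(w : t.+1.-tuple T | P w) F w
  = \sum_z \sum_(w : t.-tuple T | P (z :: w)) F (z :: w).
Proof.
rewrite pair_big_dep /=.
rewrite (reindex (fun p : T * t.-tuple T => [tuple of p.1 :: p.2])) //=.
exists (fun w : t.+1.-tuple T => (thead w, [tuple of behead w])) => [[z w]|w] _ /=.
  by rewrite theadE; congr pair; exact/val_inj.
by rewrite -tuple_eta.
Qed.

(** * The expected hitting time of the trajectories *)

Section HittingTime.
Variables (R : realType) (T : finType) (q : T -> T -> R).

Lemma hitting_prob0 (x y : T) : hitting_prob q x y 0 = (x == y)%:R.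
Proof.
rewrite /hitting_prob (eq_bigl (fun=> x == y)); last first.
  by move=> w; rewrite tuple0 /=; case: (x == y).
case: eqP => _; last by rewrite big_pred0.
by rewrite (big_pred1 [tuple]) // => w; rewrite [w]tuple0 /= eqxx.
Qed.

Lemma hitting_probS (x y : T) (t : nat) :
  hitting_prob q x y t.+1 =
  if x == y then 0 else \sum_z q x z * hitting_prob q z y t.
Proof.
rewrite /hitting_prob (@big_tuple_cons _ _ t (fun w => index y (x :: w) == t.+1)
  (path_prob q x)) /=.
case: eqP => _; first by rewrite big1 // => z _; rewrite big_pred0.
by apply: eq_bigr => z _; rewrite mulr_sumr.
Qed.

Hypothesis q_ge0 : forall x y, 0 <= q x y.
Hypothesis q_sum1 : forall x, \sum_y q x y = 1.
Hypothesis q_sym : forall x y, q x y = q y x.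
Hypothesis q_connect : forall x y, connect (fun a b => 0 < q a b) x y.

Lemma path_prob_ge0 (x : T) (w : seq T) : 0 <= path_prob q x w.
Proof. by elim: w x => //= z w IHw x; rewrite mulr_ge0. Qed.

Lemma hitting_prob_ge0 (x y : T) (t : nat) : 0 <= hitting_prob q x y t.
Proof. by apply: sumr_ge0 => w _; exact: path_prob_ge0. Qed.

(* P(T_y < n) and E(T_y ; T_y < n) for the walk started at x. *)
Let total x y n : R := \sum_(0 <= t < n) hitting_prob q x y t.
Let moment x y n : R := \sum_(0 <= t < n) t%:R * hitting_prob q x y t.

Let totalS n x y : total x y n.+1 =
  if x == y then 1 else \sum_z q x z * total z y n.
Proof.
rewrite /total big_nat_recl // hitting_prob0.
under eq_bigr do rewrite hitting_probS.
case: eqP => _; first by rewrite big1 ?addr0.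
by rewrite add0r exchange_big; apply: eq_bigr => z _; rewrite mulr_sumr.
Qed.

Let momentS n x y : moment x y n.+1 =
  if x == y then 0 else \sum_z q x z * (moment z y n + total z y n).
Proof.
rewrite /moment big_nat_recl // mul0r add0r.
under eq_bigr do rewrite hitting_probS.
case: eqP => _; first by rewrite big1 // => i _; rewrite mulr0.
rewrite (eq_bigr (fun t => \sum_z q x z *
  (t%:R * hitting_prob q z y t + hitting_prob q z y t))); last first.
  move=> t _; rewrite mulr_sumr; apply: eq_bigr => z _.
  by rewrite -natr1; ring.
rewrite exchange_big; apply: eq_bigr => z _ /=.
by rewrite -mulr_sumr big_split.
Qed.

Let total_le1 n x y : total x y n <= 1.
Proof.
elim: n x => [|n IHn] x; first by rewrite /total big_geq.
by rewrite totalS; case: eqP => // _; exact: mean_le.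
Qed.

(* The truncated moments satisfy the first-step recursion with P(T_y < n) <= 1
   in place of 1, so they stay below its solution. *)
Let moment_le n x y : moment x y n <= hit q y x.
Proof.
elim: n x => [|n IHn] x; first by rewrite /moment big_geq // hit_ge0.
rewrite momentS; case: eqP => [->|/eqP xy]; first by rewrite hit_target.
rewrite hit_step // -{1}(q_sum1 x) -big_split /=; apply: ler_sum => z _.
have -> : q x z + q x z * hit q y z = q x z * (hit q y z + 1) by ring.
by rewrite ler_wpM2l // lerD.
Qed.

Let cvg_total x y : total x y n @[n --> \oo] --> limn (total x y).
Proof.
apply: nondecreasing_is_cvgn; last by exists 1 => _ [n _ <-]; exact: total_le1.
apply/nondecreasing_seqP => n; rewrite /total big_nat_recr //= lerDl.
exact: hitting_prob_ge0.
Qed.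

Let cvg_moment x y : moment x y n @[n --> \oo] --> limn (moment x y).
Proof.
apply: nondecreasing_is_cvgn.
  apply/nondecreasing_seqP => n; rewrite /moment big_nat_recr //= lerDl.
  by rewrite mulr_ge0 // hitting_prob_ge0.
by exists (hit q y x) => _ [n _ <-]; exact: moment_le.
Qed.

Let cvg_mean x (u : nat -> T -> R) (l : T -> R) :
  (forall z, u n z @[n --> \oo] --> l z) ->
  \sum_z q x z * u n z @[n --> \oo] --> \sum_z q x z * l z.
Proof.
move=> ul; apply: cvg_big => [|z _]; first exact: add_continuous.
by apply: cvgM => //; exact: cvg_cst.
Qed.

(* The limits satisfy the first-step equations, whose solution is unique. *)
Let lim_total x y : limn (total x y) = 1.
Proof.
have bE z : limn (total z y)
    = if z == y then 1 else \sum_w q z w * limn (total w y).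
  have tS : total z y n.+1 @[n --> \oo] --> limn (total z y).
    by rewrite (@cvg_shiftS _ (total z y)); exact: cvg_total.
  apply: (cvg_unique _ tS); first exact: norm_hausdorff.
  rewrite /=; under eq_fun do rewrite totalS.
  case: eqP => _; first exact: cvg_cst.
  by apply: cvg_mean => w; exact: cvg_total.
apply/eqP; rewrite -subr_eq0; apply/eqP.
apply: (@harmonic_off_eq0 _ _ q q_ge0 q_sum1 q_connect y
  (fun x => limn (total x y) - 1)) => [|z zy].
  by rewrite bE eqxx subrr.
rewrite bE (negbTE zy) -{1}(q_sum1 z) -sumrB; apply: eq_bigr => w _.
by rewrite mulrBr mulr1.
Qed.

Let lim_moment x y : limn (moment x y) = hit q y x.
Proof.
have aE z : limn (moment z y)
    = if z == y then 0 else \sum_w q z w * (limn (moment w y) + 1).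
  have mS : moment z y n.+1 @[n --> \oo] --> limn (moment z y).
    by rewrite (@cvg_shiftS _ (moment z y)); exact: cvg_moment.
  apply: (cvg_unique _ mS); first exact: norm_hausdorff.
  rewrite /=; under eq_fun do rewrite momentS.
  case: eqP => _; first exact: cvg_cst.
  apply: cvg_mean => w; apply: cvgD; first exact: cvg_moment.
  by rewrite -(lim_total w y); exact: cvg_total.
apply/eqP; rewrite -subr_eq0; apply/eqP.
apply: (@harmonic_off_eq0 _ _ q q_ge0 q_sum1 q_connect y
  (fun x => limn (moment x y) - hit q y x)) => [|z zy].
  by rewrite aE eqxx hit_target // subrr.
rewrite aE (negbTE zy) hit_step // -{2}(q_sum1 z) -big_split -sumrB /=.
by apply: eq_bigr => w _; ring.
Qed.

(** As the chain reaches [y] almost surely, the infinite part of the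
    expectation has weight 1 - 1 = 0. *)
Lemma expected_hitting_timeE (x y : T) :
  expected_hitting_time q x y = (hit q y x)%:E.
Proof.
rewrite /expected_hitting_time.
have -> : (\sum_(0 <= t <oo) (hitting_prob q x y t)%:E)%E = 1%E.
  apply/cvg_lim => //; under eq_fun do rewrite sumEFin.
  by apply: cvg_EFin; [exact: nearW | rewrite -(lim_total x y); exact: cvg_total].
have -> : (\sum_(0 <= t <oo) (t%:R * hitting_prob q x y t)%:E)%E = (hit q y x)%:E.
  apply/cvg_lim => //; under eq_fun do rewrite sumEFin.
  by apply: cvg_EFin; [exact: nearW | rewrite -(lim_moment x y); exact: cvg_moment].
by rewrite subee // mule0 adde0.
Qed.

Definition max_hit : R :=
  \big[Order.max/0]_(x : T) \big[Order.max/0]_(y : T) hit q y x.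

Lemma maximal_hitting_timeE : maximal_hitting_time q = max_hit%:E.
Proof.
rewrite /maximal_hitting_time /max_hit.
rewrite (big_morph EFin (id1 := 0%E) (op1 := maxe)) //.
  apply: eq_bigr => x _; rewrite (big_morph EFin (id1 := 0%E) (op1 := maxe)) //.
    by apply: eq_bigr => y _; exact: expected_hitting_timeE.
  exact: EFin_max.
exact: EFin_max.
Qed.

Lemma hit_le_max (x y : T) : hit q y x <= max_hit.
Proof.
rewrite /max_hit; apply: le_trans (_ : \big[Order.max/0]_z hit q z x <= _).
  exact: (le_bigmax _ (fun z => hit q z x)).
exact: (le_bigmax _ (fun x => \big[Order.max/0]_z hit q z x)).
Qed.

Lemma max_hit_le (B : R) : 0 <= B -> (forall x y, hit q y x <= B) -> max_hit <= B.
Proof.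
by move=> B0 hB; apply: bigmax_le => // x _; apply: bigmax_le => // y _.
Qed.

End HittingTime.

(** * Resolvents of normal matrices *)

Lemma mx11_dot (C : numClosedFieldType) n (a b : 'rV[C]_n) :
  (a *m (map_mx Num.conj b^T)) 0 0 = \sum_i a 0 i * (b 0 i)^*.
Proof. by rewrite mxE; apply: eq_bigr => i _; rewrite !mxE. Qed.

(** In an orthonormal basis of eigenvectors, with eigenvalues d_i, let w_i be
    the coordinates of [h].  Those of [e] are (1 - d_i) w_i, so the two sides
    are at most k \sum |1 - d_i| |w_i|^2 and equal to
    \sum |1 - d_i|^2 |w_i|^2 respectively, and k <= 1 - |d_i| <= |1 - d_i|. *)
Lemma normalmx_resolvent_le (C : numClosedFieldType) n (A : 'M[C]_n)
    (h e : 'rV[C]_n) (k : C) :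
  A \is normalmx -> 0 <= k ->
  (forall l, eigenvalue A l -> k <= 1 - `|l|) ->
  e = h - h *m A ->
  k * `|\sum_i h 0 i * (e 0 i)^*| <= \sum_i `|e 0 i| ^+ 2.
Proof.
move=> /orthomx_spectralP A_diag k0 gap eA.
set U := spectralmx A in A_diag; set d := spectral_diag A in A_diag.
have Uu : U \is unitarymx := spectral_unitarymx A.
have Uunit := unitarymx_unit Uu.
have dgap i : k <= `|1 - d 0 i|.
  apply: le_trans (_ : 1 - `|d 0 i| <= _); last first.
    by rewrite -{1}[1]normr1; exact: lerB_dist.
  apply: gap; apply/eigenvalueP; exists (row i U).
    rewrite -row_mul {1}A_diag !mulmxA mulmxV // mul1mx.
    by apply/rowP => j; rewrite mul_diag_mx !mxE.
  apply/eqP => Ui0; have /rowP/(_ i) := row_mul i U (invmx U).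
  by rewrite Ui0 mul0mx mulmxV // !mxE eqxx => /eqP; rewrite oner_eq0.
pose w := h *m invmx U; pose z := w *m (1%:M - diag_mx d).
have hE : h = w *m U by rewrite /w mulmxKV.
have eE : e = z *m U.
  by rewrite eA /z {1}A_diag !mulmxA -/w mulmxBr mulmx1 mulmxBl -hE.
have zE i : z 0 i = w 0 i * (1 - d 0 i).
  by rewrite /z mulmxBr mulmx1 mul_mx_diag !mxE mulrBr mulr1.
have dot_inv (a b : 'rV[C]_n) :
    \sum_i (a *m U) 0 i * ((b *m U) 0 i)^* = \sum_i a 0 i * (b 0 i)^*.
  rewrite -!mx11_dot trmx_mul map_mxM /= mulmxA.
  by rewrite -[a *m U *m _]mulmxA (unitarymxP Uu) mulmx1.
have -> : \sum_i `|e 0 i| ^+ 2 = \sum_i `|z 0 i| ^+ 2.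
  under eq_bigr do rewrite normCK; rewrite eE dot_inv.
  by under eq_bigr do rewrite -normCK.
rewrite {1}hE eE dot_inv.
apply: le_trans (ler_wpM2l k0 (ler_norm_sum _ _ _)) _.
rewrite mulr_sumr; apply: ler_sum => i _.
rewrite normrM norm_conjC mulrA expr2 ler_wpM2r // zE normrM mulrC.
by rewrite ler_wpM2l.
Qed.

Lemma normc_ge0 (R : rcfType) (z : R[i]) : 0 <= Normc.normc z.
Proof. by case: z => a b; rewrite /= sqrtr_ge0. Qed.

Lemma normc_real (R : rcfType) (r : R) : Normc.normc r%:C = `|r|.
Proof. by rewrite /= expr0n addr0 sqrtr_sqr. Qed.

Lemma normc_sum (R : rcfType) (I : finType) (F : I -> R[i]) :
  Normc.normc (\sum_i F i) <= \sum_i Normc.normc (F i).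
Proof.
elim/big_ind2: _ => [|a x b y ax b_y|//]; first by rewrite Normc.normc0.
by apply: le_trans (le_normcD _ _) _; exact: lerD.
Qed.

(** [normalmx_resolvent_le] for real data; the gap is still assumed for complex
    eigenvalues because the relaxation time is defined through them. *)
Lemma symmetric_resolvent_le (R : rcfType) n (A : 'M[R]_n) (h e : 'rV[R]_n)
    (k : R) :
  A^T = A -> 0 <= k ->
  (forall l, eigenvalue (map_mx (real_complex R) A) l ->
    Normc.normc l <= 1 - k) ->
  e = h - h *m A ->
  k * (\sum_i h 0 i * e 0 i) <= \sum_i e 0 i ^+ 2.
Proof.
move=> A_sym k0 gap eA.
have conj_toC (r : R) : (r%:C)^* = r%:C :> R[i] by exact: conjc_real.
have A_normal : toC A \is normalmx.
  apply/normalmxP; rewrite (_ : map_mx Num.conj _ = toC A) //.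
  by apply/matrixP => i j; rewrite !mxE conj_toC -{1}A_sym mxE.
have eAC : toC e = toC h - toC h *m toC A.
  by rewrite -map_mxM -map_mxB eA.
have gapC l : eigenvalue (toC A) l -> k%:C <= 1 - `|l|.
  by move=> /gap; rewrite -(rmorph1 (real_complex R)) -rmorphB lecR; lra.
have k0C : 0 <= k%:C :> R[i] by rewrite -(rmorph0 (real_complex R)) lecR.
have := normalmx_resolvent_le A_normal k0C gapC eAC.
have -> : \sum_i toC h 0 i * (toC e 0 i)^* = (\sum_i h 0 i * e 0 i)%:C.
  by rewrite rmorph_sum; apply: eq_bigr => i _; rewrite !mxE conj_toC -rmorphM.
have -> : \sum_i `|toC e 0 i| ^+ 2 = (\sum_i e 0 i ^+ 2)%:C.
  rewrite rmorph_sum; apply: eq_bigr => i _.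
  by rewrite normCK !mxE conj_toC -expr2 rmorphXn.
rewrite -[`|_%:C|]/(_%:C) normc_real -rmorphM lecR; apply: le_trans.
by rewrite ler_wpM2l // ler_norm.
Qed.

Lemma eigenvalue_transitionP (R : realType) (T : finType) (K : T -> T -> R)
    (l : R[i]) :
  eigenvalue (map_mx (real_complex R) (transition_mx K)) l <->
  exists2 phi : T -> R[i], (exists x, phi x != 0) &
    forall y, \sum_x phi x * (K x y)%:C = l * phi y.
Proof.
split=> [/eigenvalueP[v vE v0]|[phi [x phix0] phiE]].
  exists (fun x => v 0 (enum_rank x)) => [|y].
    by have /rV0Pn[i vi0] := v0; exists (enum_val i); rewrite enum_valK.
  have /rowP/(_ (enum_rank y)) := vE; rewrite !mxE => <-.
  rewrite sum_enum_val; apply: eq_bigr => i _.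
  by rewrite !mxE enum_valK enum_rankK.
apply/eigenvalueP; exists (\row_i phi (enum_val i)).
  apply/rowP => j; rewrite !mxE -phiE [RHS]sum_enum_val.
  by apply: eq_bigr => i _; rewrite !mxE.
by apply/rV0Pn; exists (enum_rank x); rewrite mxE enum_rankK.
Qed.

(** * The lamplighter kernel *)

Section LampKernel.
Variables (R : realType) (T : finType) (q : T -> T -> R).
Implicit Types (f h : {ffun T -> bool}) (a b v : T).

Definition flip v f : {ffun T -> bool} := [ffun w => f w (+) (w == v)].

Lemma flipK v : involutive (flip v).
Proof. by move=> f; apply/ffunP => w; rewrite !ffunE addbK. Qed.

Lemma sum_flip (V : nmodType) v (F : {ffun T -> bool} -> V) :
  \sum_f F (flip v f) = \sum_f F f.
Proof. by rewrite [RHS](reindex_inj (inv_inj (flipK v))). Qed.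

Lemma flip_invariant (V : Type) (F : {ffun T -> bool} -> V) :
  (forall v f, F (flip v f) = F f) -> forall f h, F f = F h.
Proof.
move=> Finv; suff off f : F f = F [ffun=> false] by move=> f h; rewrite !off.
have [n] := ubnP #|[pred v | f v]|; elim: n f => // n IHn f fn.
have [v fv|f0] := pickP [pred v | f v]; last first.
  by congr F; apply/ffunP => v; rewrite ffunE; exact: f0.
rewrite -(Finv v) IHn //; move: fn; rewrite (cardD1 v) inE [f v]fv add1n ltnS.
apply: leq_ltn_trans; apply/subset_leq_card/fintype.subsetP => w.
rewrite !inE ffunE; have [->|_] := eqVneq w v; last by rewrite addbF.
by move: fv => /= ->.
Qed.

Definition agree_off a b f h := [forall v, (v != a) && (v != b) ==> (f v == h v)].

Lemma agree_offC a b f h : agree_off a b f h = agree_off b a h f.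
Proof. by apply: eq_forallb => v; rewrite andbC [f v == _]eq_sym. Qed.

Lemma agree_off_flip v a b f h :
  agree_off a b (flip v f) (flip v h) = agree_off a b f h.
Proof. by apply: eq_forallb => w; rewrite !ffunE (inj_eq (@addIb _)). Qed.

Lemma agree_off_flipr v a b f h : v \in pred2 a b ->
  agree_off a b f (flip v h) = agree_off a b f h.
Proof.
move=> vab; apply: eq_forallb => w; rewrite !ffunE.
have [->|_] := eqVneq w v; last by rewrite addbF.
by case/pred2P: vab => ->; rewrite eqxx ?andbF.
Qed.

(** The indicator is a product over the vertices, so the sum over the
    configurations factors; each refreshed lamp contributes a factor 2. *)
Lemma sum_agree_off a b f :
  \sum_h (agree_off a b f h)%:R = 2 ^+ #|pred2 a b| :> R.
Proof.
pose F w (c : bool) : R := if pred2 a b w then 1 else (f w == c)%:R.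
have agreeE h : (agree_off a b f h)%:R = \prod_w F w (h w).
  rewrite /agree_off -big_andE (big_morph (fun c : bool => c%:R : R)
    (op1 := *%R) (id1 := 1)) //; last by move=> c d; rewrite -natrM mulnb.
  by rewrite big_mkcond; apply: eq_bigr => w _; rewrite /F -negb_or if_neg.
rewrite (eq_bigr _ (fun h _ => agreeE h)).
rewrite -(bigA_distr_bigA F) /= -prodr_const [RHS]big_mkcond /=.
apply: eq_bigr => w _; rewrite big_bool /F /= inE.
by case: ifP => // _; case: (f w); rewrite /= ?addr0 ?add0r.
Qed.

(** The two cases of the walk in one formula: the lamps at the ends of the
    step, one or two of them, are refreshed independently and uniformly. *)
Lemma lamplighterE f a h b :
  lamplighter q (f, a) (h, b) =
  q a b * (agree_off a b f h)%:R / 2 ^+ #|pred2 a b|.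
Proof.
rewrite /lamplighter card2 /agree_off; have [<-|ab] := eqVneq a b.
  have -> : [forall v, (v != a) && (v != a) ==> (f v == h v)]
          = [forall v, (v != a) ==> (f v == h v)].
    by apply: eq_forallb => v; rewrite andbb.
  by case: ifP => _; rewrite ?mulr1 ?mulr0 ?mul0r.
rewrite -natrX; case: ifP => _; rewrite ?mulr1 ?mulr0 ?mul0r //.
Qed.

Lemma lamplighter_ge0 s s' : (forall a b, 0 <= q a b) -> 0 <= lamplighter q s s'.
Proof.
by case: s s' => [f a] [h b] q_ge0; rewrite lamplighterE !mulr_ge0.
Qed.

Lemma lamplighter_sym s s' : (forall a b, q a b = q b a) ->
  lamplighter q s s' = lamplighter q s' s.
Proof.
case: s s' => [f a] [h b] q_sym; rewrite !lamplighterE q_sym agree_offC.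
by rewrite !card2 eq_sym.
Qed.

Lemma lamplighter_flip v f a h b :
  lamplighter q (flip v f, a) (flip v h, b) = lamplighter q (f, a) (h, b).
Proof. by rewrite !lamplighterE agree_off_flip. Qed.

Lemma lamplighter_flipr v f a h b : v \in pred2 a b ->
  lamplighter q (f, a) (flip v h, b) = lamplighter q (f, a) (h, b).
Proof. by move=> vab; rewrite !lamplighterE agree_off_flipr. Qed.

Lemma lamplighter_sum f a b :
  \sum_h lamplighter q (f, a) (h, b) = q a b.
Proof.
under eq_bigr do rewrite lamplighterE.
by rewrite -mulr_suml -mulr_sumr sum_agree_off mulfK.
Qed.

(** On functions odd in the lamp at [v] the step operator is that of the walk
    killed at [v]: a step that starts or ends at [v] refreshes the lamp, so the
    two signs cancel, and any other step leaves the sign unchanged. *)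
Lemma lamplighter_char_sum v f a b : (forall a b, q a b = q b a) ->
  \sum_(h : {ffun T -> bool}) (-1) ^+ h v * lamplighter q (h, a) (f, b) =
  (-1) ^+ f v * killed q v a b :> R.
Proof.
move=> q_sym; rewrite /killed; case: ifP => vab.
  set S := \sum_h _; suff : S = - S by lra.
  rewrite {1}/S -(sum_flip v) -sumrN; apply: eq_bigr => h _.
  rewrite ffunE eqxx addbT signrN mulNr lamplighter_sym //.
  rewrite lamplighter_flipr ?(lamplighter_sym (f, b)) //.
  by rewrite inE orbC ![v == _]eq_sym.
rewrite q_sym -(lamplighter_sum f b a) mulr_sumr; apply: eq_bigr => h _.
rewrite (lamplighter_sym (h, a)) // lamplighterE.
case: (boolP (agree_off b a f h)) => [/forallP/(_ v)|_];
  last by rewrite mulr0 mul0r !mulr0.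
by rewrite andbC -negb_or ![v == _]eq_sym vab /= => /eqP ->.
Qed.

End LampKernel.

(** * Eigenvalues of the walk on the graph *)

Section Gap.
Variables (R : realType) (T : finType) (q : T -> T -> R) (d : nat).
Hypothesis q_ge0 : forall x y, 0 <= q x y.
Hypothesis q_sum1 : forall x, \sum_y q x y = 1.
Hypothesis q_sym : forall x y, q x y = q y x.
Hypothesis q_connect : forall x y, connect (fun a b => 0 < q a b) x y.
Hypothesis q_trans : forall x y,
  exists2 s : {perm T}, forall a b, q (s a) (s b) = q a b & s x = y.
Hypothesis d_bound : (0 < d <= #|T|)%N.
Hypothesis q_int : forall x y, d%:R * q x y \is a Num.int.
Hypothesis T_gt1 : (1 < #|T|)%N.

Let t : R := max_hit q.

Lemma card_le_max_hit : #|T|%:R <= 2 * t.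
Proof.
have [y _] : exists y : T, true.
  by case/card_gt0P: (ltnW T_gt1) => y _; exists y.
have := card_le_hit q_ge0 q_sum1 q_sym q_connect (fun x => hit_le_max q x y).
rewrite -/t; have : 2 <= #|T|%:R :> R by rewrite ler_nat.
lra.
Qed.

Lemma max_hit_ge1 : 1 <= 2 * t.
Proof. by apply: le_trans card_le_max_hit; rewrite ler1n ltnW. Qed.

(** The modulus of [g] is a subsolution for the walk killed at [v]. *)
Lemma vanishing_gap (v : T) (g : T -> R) (lam : R) :
  (exists x, g x != 0) -> g v = 0 -> `|lam| < 1 ->
  (forall x, \sum_z q x z * g z = lam * g x) -> 1 <= (1 - `|lam|) * (2 * t).
Proof.
move=> [x gx] gv0 lam1 gE.
have : 1 <= (1 - `|lam|) * t.
  apply: (subsolution_gap q_ge0 q_sum1 q_sym q_connect (u := fun x => `|g x|) (v := v)).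
  - by move=> z; exact: normr_ge0.
  - by rewrite gv0 normr0.
  - by exists x; rewrite normr_eq0.
  - move=> z; rewrite -normrM -gE; apply: le_trans (ler_norm_sum _ _ _) _.
    by apply: ler_sum => w _; rewrite normrM ger0_norm.
  - by move=> z; exact: hit_le_max.
rewrite mulrCA; lra.
Qed.

(** If [g] has no zero, the combinations g(v) g(s x) - g(s v) g(x) vanish at
    x = v.  When all of them are identically zero, |g| is constant, and the
    eigenvector equation divided by g at one vertex shows that d lam is a sum
    of integers. *)
Lemma real_gap (g : T -> R) (lam : R) :
  (exists x, g x != 0) -> `|lam| < 1 ->
  (forall x, \sum_z q x z * g z = lam * g x) -> 1 <= (1 - `|lam|) * (2 * t).
Proof.
move=> g_neq0 lam1 gE.
have [/existsP[v /eqP gv0]|gN0] := boolP [exists v, g v == 0].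
  exact: vanishing_gap gv0 lam1 gE.
have g0 x : g x != 0 by move: gN0; rewrite negb_exists => /forallP.
have [ratioP|] := pselect (forall (s : {perm T}) v x,
    (forall a b, q (s a) (s b) = q a b) -> g v * g (s x) = g (s v) * g x).
  (* The relation at a maximum of |g| gives |g (s v)| <= |g v| for all s, v. *)
  have [x0 _] := g_neq0.
  have [x1 _ x1max] := @arg_maxP _ _ _ x0 xpredT (fun x => `|g x|) isT.
  have {}x1max z : `|g z| <= `|g x1| by exact: x1max.
  have gM z : `|g z| = `|g x1|.
    have [s sP sz] := q_trans z x1.
    apply/eqP; rewrite eq_le x1max /= -sz.
    have gx1 : 0 < `|g x1| by rewrite normr_gt0.
    rewrite -(ler_pM2r gx1) -normrM -ratioP // normrM.
    by rewrite ler_pM2l ?normr_gt0 //; exact: x1max.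
  have lam_int : d%:R * lam \is a Num.int.
    have -> : d%:R * lam = \sum_z d%:R * q x1 z * (g z / g x1).
      rewrite -[lam](mulfK (g0 x1)) -gE mulr_suml mulr_sumr.
      by apply: eq_bigr => z _; rewrite !mulrA.
    apply: rpred_sum => z _; apply: rpredM => //.
    have : `|g z / g x1| == 1 by rewrite normrM normfV gM divff ?normr_eq0.
    by rewrite eqr_norml ler01 andbT => /orP[] /eqP ->; rewrite ?rpredN rpred1.
  case/andP: d_bound => d_gt0 d_le.
  have d0 : 0 < d%:R :> R by rewrite ltr0n.
  have dlam : d%:R * `|lam| <= d%:R - 1.
    case/intrP: lam_int => m mE.
    have dE : d%:R * `|lam| = `|m|%:~R by rewrite intr_norm -mE normrM normr_nat.
    have : `|m| < d%:Z by rewrite -(ltr_int R) -dE gtr_pMr.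
    by rewrite -lezD1 -(ler_int R) intrD -dE lerBrDr.
  apply: le_trans (_ : (1 - `|lam|) * d%:R <= _); first by lra.
  apply: ler_wpM2l; first by rewrite subr_ge0 ltW.
  by apply: le_trans card_le_max_hit; rewrite ler_nat.
move=> /existsNP[s] /existsNP[v] /existsNP[x] /not_implyP[sP /eqP ratioN].
apply: (@vanishing_gap v (fun x => g v * g (s x) - g (s v) * g x)) => //.
- by exists x; rewrite subr_eq0.
- by rewrite mulrC subrr.
- move=> z; have -> : lam * (g v * g (s z) - g (s v) * g z)
      = g v * (lam * g (s z)) - g (s v) * (lam * g z) by ring.
  have gsE : \sum_w q z w * g (s w) = lam * g (s z).
    rewrite -gE [RHS](reindex_inj (@perm_inj _ s)).
    by apply: eq_bigr => w _; rewrite sP.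
  rewrite -gsE -gE !mulr_sumr -sumrB.
  by apply: eq_bigr => w _; ring.
Qed.

(** Symmetry of [q] makes the eigenvalue real, and then the real or the
    imaginary part of the eigenvector is an eigenvector. *)
Lemma complex_gap (phi : T -> R[i]) (l : R[i]) :
  (exists x, phi x != 0) -> Normc.normc l < 1 ->
  (forall y, \sum_x phi x * (q x y)%:C = l * phi y) ->
  1 <= (1 - Normc.normc l) * (2 * t).
Proof.
case: l => lam mu; set l := Complex lam mu => phi_neq0 l1 phiE.
pose a x := complex.Re (phi x); pose b x := complex.Im (phi x).
have parts y : (\sum_x q y x * a x = lam * a y - mu * b y) /\
    (\sum_x q y x * b x = lam * b y + mu * a y).
  have real_mul (z : R[i]) r : complex.Re (z * r%:C) = r * complex.Re z /\
      complex.Im (z * r%:C) = r * complex.Im z.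
    by case: z => u v /=; split; ring.
  have ReE : complex.Re (l * phi y) = \sum_x q y x * a x.
    rewrite -phiE (big_morph (@complex.Re R) (op1 := +%R) (id1 := 0)) //; last first.
      by move=> [? ?] [? ?].
    by apply: eq_bigr => x _; rewrite q_sym; have [-> _] := real_mul (phi x) (q y x).
  have ImE : complex.Im (l * phi y) = \sum_x q y x * b x.
    rewrite -phiE (big_morph (@complex.Im R) (op1 := +%R) (id1 := 0)) //; last first.
      by move=> [? ?] [? ?].
    by apply: eq_bigr => x _; rewrite q_sym; have [_ ->] := real_mul (phi x) (q y x).
  by rewrite -ReE -ImE /a /b /l; case: (phi y) => u v /=; split; ring.
have norm_gt0 : 0 < \sum_x (a x ^+ 2 + b x ^+ 2).
  have [x phix] := phi_neq0.
  rewrite (bigD1 x) //= ltr_pwDl ?sumr_ge0 //; last first.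
    by move=> z _; rewrite addr_ge0 ?sqr_ge0.
  rewrite lt_neqAle addr_ge0 ?sqr_ge0 // andbT eq_sym paddr_eq0 ?sqr_ge0 //.
  rewrite !sqrf_eq0 /a /b; move: phix; case: (phi x) => u v /=.
  by rewrite eq_complex.
have mu0 : mu = 0.
  have : \sum_y b y * (\sum_x q y x * a x) = \sum_y a y * (\sum_x q y x * b x).
    under eq_bigr do rewrite mulr_sumr.
    under [RHS]eq_bigr do rewrite mulr_sumr.
    rewrite exchange_big; apply: eq_bigr => y _; apply: eq_bigr => x _.
    by rewrite q_sym; ring.
  move/eqP; rewrite -subr_eq0 -sumrB.
  have -> : \sum_y (b y * (\sum_x q y x * a x) - a y * (\sum_x q y x * b x))
      = - mu * \sum_x (a x ^+ 2 + b x ^+ 2).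
    rewrite mulr_sumr; apply: eq_bigr => y _.
    by have [-> ->] := parts y; ring.
  by rewrite mulf_eq0 (gt_eqF norm_gt0) orbF oppr_eq0 => /eqP.
move: l1; rewrite /l mu0 -[(lam +i* 0)%C]/(lam%:C) normc_real => lam1.
have [[x ax]|a0] := pselect (exists x, a x != 0).
  apply: (@real_gap a) => //; first by exists x.
  by move=> y; have [-> _] := parts y; rewrite mu0 mul0r subr0.
apply: (@real_gap b) => //.
  have [x phix] := phi_neq0; exists x; apply: contra_neq phix => bx0.
  have ax0 : a x = 0 by apply/eqP; apply: contra_notT a0 => ax; exists x.
  by move: ax0 bx0; rewrite /a /b; case: (phi x) => u v /= -> ->.
by move=> y; have [_ ->] := parts y; rewrite mu0 mul0r addr0.
Qed.
End Gap.

(** * Eigenvalues of the lamplighter walk *)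

Local Arguments lamplighter : simpl never.

Lemma le1_mul2 (R : realDomainType) (a b : R) : 1 <= a * b -> 1 <= a * (2 * b).
Proof. by rewrite mulrCA; lra. Qed.

Lemma le1_mul_gt0 (R : realDomainType) (a b : R) : 0 <= b -> 1 <= a * b -> 0 < a.
Proof.
move=> b0 ab; rewrite ltNge; apply/negP => a0.
by have := mulr_le0_ge0 a0 b0; lra.
Qed.

Lemma normcMr (R : rcfType) (z : R[i]) (r : R) :
  0 <= r -> Normc.normc (z * r%:C) = Normc.normc z * r.
Proof. by move=> r0; rewrite Normc.normcM normc_real ger0_norm. Qed.

Lemma normc_subsolution (R : realType) (T : finType) (K : T -> T -> R)
    (phi : T -> R[i]) (l : R[i]) (y : T) :
  (forall x y, 0 <= K x y) -> \sum_x phi x * (K x y)%:C = l * phi y ->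
  Normc.normc l * Normc.normc (phi y) <= \sum_x Normc.normc (phi x) * K x y.
Proof.
move=> K_ge0 phiE; rewrite -Normc.normcM -phiE.
apply: le_trans (normc_sum _) _; apply: ler_sum => x _.
by rewrite normcMr.
Qed.

Lemma sum_lamp (V : nmodType) (T : finType) (F : lamplighter_state T -> V) :
  \sum_s F s = \sum_x \sum_f F (f, x).
Proof. by rewrite exchange_big pair_big /=; apply: eq_bigr => -[]. Qed.

Section LampGap.
Variables (R : realType) (T : finType) (q : T -> T -> R) (d : nat).
Hypothesis q_ge0 : forall x y, 0 <= q x y.
Hypothesis q_sum1 : forall x, \sum_y q x y = 1.
Hypothesis q_sym : forall x y, q x y = q y x.
Hypothesis q_connect : forall x y, connect (fun a b => 0 < q a b) x y.

Let t : R := max_hit q.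

Lemma subsolution_gap_max (v : T) (u : T -> R) (r : R) :
  (forall x, 0 <= u x) -> u v = 0 -> (exists x, u x != 0) ->
  (forall x, r * u x <= \sum_z q x z * u z) -> 1 <= (1 - r) * t.
Proof.
move=> u0 uv ux usub.
by apply: (subsolution_gap q_ge0 q_sum1 q_sym q_connect u0 uv ux usub) => x;
  exact: hit_le_max.
Qed.

Lemma max_hit_ge0 : 0 <= t. Proof. exact: bigmax_ge_id. Qed.

(** Entering [v] refreshes the lamp there, so, as l is nonzero, psi(h,v) is
    both even and odd in that lamp and vanishes.  The sum of the moduli over
    the configurations is then a subsolution for the walk killed at [v]. *)
Lemma lamplighter_odd_gap (v : T) (psi : lamplighter_state T -> R[i]) (l : R[i]) :
  l != 0 -> (exists s, psi s != 0) ->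
  (forall f x, psi (flip v f, x) = - psi (f, x)) ->
  (forall s', \sum_s psi s * (lamplighter q s s')%:C = l * psi s') ->
  1 <= (1 - Normc.normc l) * t.
Proof.
move=> l0 [[f0 x0] psi0] psi_odd psiE.
have psi_v h : psi (h, v) = 0.
  have : l * psi (flip v h, v) = l * psi (h, v).
    rewrite -!psiE; apply: eq_bigr => -[f a] _.
    by rewrite lamplighter_flipr // inE eqxx orbT.
  move/(mulfI l0); rewrite psi_odd => /eqP.
  by rewrite eq_sym -addr_eq0 -mulr2n mulrn_eq0 /= => /eqP.
pose u x := \sum_f Normc.normc (psi (f, x)).
have u_ge0 x : 0 <= u x by apply: sumr_ge0 => f _; exact: normc_ge0.
apply: (subsolution_gap_max u_ge0 (v := v)).
- by rewrite /u big1 // => f _; rewrite psi_v Normc.normc0.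
- exists x0; apply: contra_neq psi0 => ux0.
  apply: Normc.eq0_normc.
  by apply: (psumr_eq0P _ ux0) => // f _; exact: normc_ge0.
move=> b; rewrite /u mulr_sumr.
apply: le_trans (_ : \sum_h \sum_s Normc.normc (psi s) * lamplighter q s (h, b) <= _).
  apply: ler_sum => h _; apply: normc_subsolution => // s s'.
  exact: lamplighter_ge0.
rewrite exchange_big sum_lamp /=; apply: ler_sum => a _.
rewrite mulr_sumr; apply: ler_sum => f _.
by rewrite -mulr_sumr lamplighter_sum mulrC q_sym.
Qed.

Hypothesis q_trans : forall x y,
  exists2 s : {perm T}, forall a b, q (s a) (s b) = q a b & s x = y.
Hypothesis d_bound : (0 < d <= #|T|)%N.
Hypothesis q_int : forall x y, d%:R * q x y \is a Num.int.
Hypothesis T_gt1 : (1 < #|T|)%N.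

(** Either some flip produces a nonzero odd part of the eigenvector, or the
    eigenvector does not depend on the lamps. *)
Lemma lamplighter_gap (phi : lamplighter_state T -> R[i]) (l : R[i]) :
  (exists s, phi s != 0) -> Normc.normc l < 1 ->
  (forall s', \sum_s phi s * (lamplighter q s s')%:C = l * phi s') ->
  1 <= (1 - Normc.normc l) * (2 * t).
Proof.
move=> phi_neq0 l1 phiE.
have [->|l0] := eqVneq l 0.
  by rewrite Normc.normc0 subr0 mul1r; apply: max_hit_ge1.
have [flip_inv|] := pselect (forall v f x, phi (flip v f, x) = phi (f, x)).
  have phi_const f h x : phi (f, x) = phi (h, x).
    by apply: (@flip_invariant _ _ (fun f => phi (f, x))) => v f'.
  pose f0 : {ffun T -> bool} := [ffun=> false].
  apply: (@complex_gap _ _ q d q_ge0 q_sum1 q_sym q_connect q_trans d_bound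
    q_int T_gt1 (fun x => phi (f0, x))) => // [|y].
    by have [[f x] fx] := phi_neq0; exists x; rewrite (phi_const _ f).
  rewrite -phiE sum_lamp; apply: eq_bigr => x _.
  rewrite q_sym -(lamplighter_sum q f0 y x) rmorph_sum mulr_sumr.
  apply: eq_bigr => f _.
  by rewrite (phi_const _ f) (lamplighter_sym (f, x)).
move=> /existsNP[v] /existsNP[f1] /existsNP[x1] /eqP flip_neq.
have : 1 <= (1 - Normc.normc l) * t.
  apply: (@lamplighter_odd_gap v (fun s => phi s - phi (flip v s.1, s.2))) => //.
  - by exists (f1, x1); rewrite subr_eq0 eq_sym.
  - by move=> f x /=; rewrite flipK opprB.
  move=> [h b] /=; rewrite mulrBr -!phiE.
  under eq_bigr do rewrite mulrBl.
  rewrite sumrB; congr (_ - _); rewrite !sum_lamp; apply: eq_bigr => x _.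
  rewrite -[LHS](sum_flip v); apply: eq_bigr => f _ /=.
  by rewrite flipK -(lamplighter_flip q v f x (flip v h)) flipK.
exact: le1_mul2.
Qed.

(** An eigenvector of the killed walk, multiplied by the sign of the lamp at
    [v], is an eigenvector of the lamplighter walk. *)
Lemma killed_eigenvalue (v : T) (l : R[i]) :
  eigenvalue (toC (transition_mx (killed q v))) l ->
  eigenvalue (toC (transition_mx (lamplighter q))) l /\ Normc.normc l < 1.
Proof.
move=> /eigenvalue_transitionP[phi [x phix] phiE]; split.
  apply/eigenvalue_transitionP.
  exists (fun s : lamplighter_state T => ((-1) ^+ s.1 v)%:C * phi s.2).
    exists ([ffun=> false], x); rewrite /= ffunE expr0 rmorph1 mul1r //.
  move=> [h b] /=; rewrite sum_lamp /=.
  rewrite mulrCA -phiE mulr_sumr; apply: eq_bigr => a _.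
  rewrite mulrCA -rmorphM -lamplighter_char_sum // rmorph_sum mulr_sumr.
  by apply: eq_bigr => f _; rewrite rmorphM mulrCA mulrA.
have [->|l0] := eqVneq l 0; first by rewrite Normc.normc0.
have phiv : phi v = 0.
  apply: (mulfI l0); rewrite -phiE mulr0 big1 // => z _.
  by rewrite /killed eqxx orbT rmorph0 mulr0.
have : 1 <= (1 - Normc.normc l) * t.
  apply: (@subsolution_gap_max v (fun x => Normc.normc (phi x))).
  - by move=> z; exact: normc_ge0.
  - by rewrite phiv Normc.normc0.
  - by exists x; apply: contra_neq phix => /Normc.eq0_normc.
  move=> y; apply: le_trans (normc_subsolution _ (phiE y)) _.
    by move=> a b; rewrite /killed; case: ifP.
  apply: ler_sum => z _; rewrite mulrC q_sym ler_wpM2r ?normc_ge0 //.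
  by rewrite /killed q_sym; case: ifP.
by move/(le1_mul_gt0 max_hit_ge0); rewrite subr_gt0.
Qed.

Let rates : set R := [set (1 - Normc.normc l)^-1 | l in
  [set l : R[i] | eigenvalue (toC (transition_mx (lamplighter q))) l /\
                  Normc.normc l < 1]].

Let rates_le r : rates r -> r <= 2 * t.
Proof.
move=> [l [/eigenvalue_transitionP[phi phi0 phiE] l1] <-].
have := lamplighter_gap phi0 l1 phiE.
have l1' : 0 < 1 - Normc.normc l by rewrite subr_gt0.
by rewrite -(ler_pdivrMl _ _ l1') mulr1.
Qed.

Let killed_rate v l : eigenvalue (toC (transition_mx (killed q v))) l ->
  rates (1 - Normc.normc l)^-1.
Proof. by move=> /killed_eigenvalue lP; exists l. Qed.

(* The indicator of [v] is in the kernel of the walk killed at [v]. *)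
Let rates_neq0 : rates 1.
Proof.
have [v _] : exists v : T, true.
  by case/card_gt0P: (ltnW T_gt1) => v _; exists v.
have := @killed_rate v 0; rewrite Normc.normc0 subr0 invr1; apply.
apply/eigenvalue_transitionP; exists (fun x => (x == v)%:R).
  by exists v; rewrite eqxx oner_eq0.
move=> y; rewrite mul0r big1 // => x _; rewrite /killed.
by case: eqP => _; rewrite ?mul0r ?rmorph0 ?mulr0.
Qed.

Let trel := relaxation_time (lamplighter q).

Lemma relaxation_time_le : trel <= 2 * t.
Proof.
by apply: ge_sup; [exists 1; exact: rates_neq0 | exact: rates_le].
Qed.

Let rate_le_relaxation_time r : rates r -> r <= trel.
Proof.
by move=> rP; apply: ub_le_sup => //; exists (2 * t) => r'; exact: rates_le.
Qed.

(** [hit q v] is the solution h of h - h [killed q v] = e, with e the indicator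
    of the complement of [v]; the resolvent estimate then compares
    \sum_x h(x) e(x) = \sum_x h(x) with the squared norm of e, at most n. *)
Lemma sum_hit_le (v : T) : \sum_x hit q v x <= trel * #|T|%:R.
Proof.
have trel_gt0 : 0 < trel.
  exact: lt_le_trans ltr01 (rate_le_relaxation_time rates_neq0).
pose h : 'rV[R]_#|T| := \row_i hit q v (enum_val i).
pose e : 'rV[R]_#|T| := \row_i (enum_val i != v)%:R.
have := @symmetric_resolvent_le _ _ (transition_mx (killed q v)) h e trel^-1.
have -> : \sum_i h 0 i * e 0 i = \sum_x hit q v x.
  rewrite [RHS]sum_enum_val; apply: eq_bigr => i _; rewrite !mxE.
  case: eqP => [->|_] /=; last by rewrite mulr1.
  by rewrite hit_target // mul0r.
move=> gap; rewrite -ler_pdivrMl //; apply: le_trans (gap _ _ _ _) _.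
- by apply/matrixP => i j; rewrite !mxE killed_sym.
- by rewrite invr_ge0 ltW.
- move=> l /[dup] /killed_eigenvalue[_ l1] /killed_rate/rate_le_relaxation_time.
  have l1' : 0 < 1 - Normc.normc l by rewrite subr_gt0.
  move=> rate_le; have : trel^-1 <= 1 - Normc.normc l.
    by rewrite -[leRHS]invrK lef_pV2 ?posrE ?invr_gt0.
  by rewrite lerBrDr -lerBrDl.
- apply/rowP => i; rewrite -(enum_valK i); set x := enum_val i.
  have hE z : h 0 (enum_rank z) = hit q v z by rewrite mxE enum_rankK.
  have -> : (h - h *m transition_mx (killed q v)) 0 (enum_rank x)
      = h 0 (enum_rank x) - (h *m transition_mx (killed q v)) 0 (enum_rank x).
    by rewrite !mxE.
  rewrite mulmx_transition; last exact: killed_sym.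
  under eq_bigr do rewrite hE.
  rewrite hE mxE enum_rankK killed_sum ?hit_target //.
  case: eqP => [->|/eqP xv] /=; first by rewrite hit_target // subr0.
  by rewrite hit_step // addrK.
apply: le_trans (_ : \sum_(i < #|T|) 1 <= _); last by rewrite sumr_const card_ord.
apply: ler_sum => i _; rewrite mxE.
by case: eqP => _ /=; rewrite ?expr0n ?expr1n.
Qed.

(** [sum_hit_le] bounds the two averages in [commute_le_mean] by T each. *)
Lemma max_hit_le_relaxation_time : t <= 4 * trel.
Proof.
have trel_ge0 : 0 <= trel.
  exact: le_trans ler01 (rate_le_relaxation_time rates_neq0).
apply: max_hit_le => [|x y]; first by rewrite mulr_ge0.
have T_gt0 : 0 < #|T|%:R :> R by rewrite ltr0n ltnW.
have := commute_le_mean q_ge0 q_sum1 q_sym q_connect x y.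
have := sum_hit_le x; have := sum_hit_le y => hy hx hxy.
rewrite -(ler_pM2l T_gt0).
apply: le_trans (_ : #|T|%:R * (hit q y x + hit q x y) <= _).
  by rewrite ler_pM2l // lerDl hit_ge0.
apply: le_trans hxy _; lra.
Qed.

End LampGap.

(** * Simple random walk on a vertex transitive graph *)

Section SimpleRandomWalk.
Variables (R : realType) (G : graph).
Hypothesis G_conn : graph_connected G.
Hypothesis G_trans : vertex_transitive G.
Hypothesis G_gt1 : (1 < #|vertex G|)%N.

Let q := @srw R G.

Lemma degree_automorphism (s : {perm G}) (x : G) :
  graph_automorphism s -> degree (s x) = degree x.
Proof.
move=> sP; rewrite /degree -[RHS](card_imset _ (@perm_inj _ s)).
apply: eq_card => y; rewrite inE; apply/idP/imsetP => [sxy|[z]].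
  exists (s^-1 y)%g; last by rewrite permKV.
  by rewrite inE -sP permKV.
by rewrite inE => xz ->; rewrite sP.
Qed.

Lemma degree_regular (x y : G) : degree x = degree y.
Proof. by have [s sP <-] := G_trans x y; rewrite degree_automorphism. Qed.

Lemma degree_gt0 (x : G) : (0 < degree x)%N.
Proof.
have [y xy] : exists y : G, x != y.
  apply/existsP; rewrite -negb_forall; apply: contraL G_gt1 => /forallP all_x.
  rewrite -leqNgt (eq_card (B := pred1 x)) ?card1 // => y.
  by rewrite !inE eq_sym all_x.
have /connectP[[|z p] /= pth yE] := G_conn.2 x y.
  by rewrite yE eqxx in xy.
by case/andP: pth => xz _; apply/card_gt0P; exists z; rewrite inE.
Qed.

Lemma srw_ge0 (x y : G) : 0 <= q x y.
Proof. by rewrite /q /srw; case: ifP. Qed.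

Lemma srw_sum (x : G) : \sum_y q x y = 1.
Proof.
rewrite /q /srw -big_mkcond sumr_const -[X in _ *+ X](_ : degree x = _).
  by rewrite -[_ *+ _]mulr_natr mulVf // pnatr_eq0 -lt0n degree_gt0.
by rewrite /degree cardsE.
Qed.

Lemma srw_sym (x y : G) : q x y = q y x.
Proof. by rewrite /q /srw adj_sym (degree_regular x y). Qed.

Lemma srw_connect (x y : G) : connect (fun a b => 0 < q a b) x y.
Proof.
have := G_conn.2 x y; apply: connect_sub => a b ab; apply: connect1.
by rewrite /q /srw ab invr_gt0 ltr0n degree_gt0.
Qed.

Lemma srw_trans (x y : G) :
  exists2 s : {perm G}, forall a b, q (s a) (s b) = q a b & s x = y.
Proof.
have [s sP sx] := G_trans x y; exists s => // a b.
by rewrite /q /srw sP degree_automorphism.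
Qed.

Lemma degree_srw_int (x0 x y : G) : (degree x0)%:R * q x y \is a Num.int.
Proof.
rewrite /q /srw (degree_regular x0 x); case: ifP => _; last by rewrite mulr0 rpred0.
by rewrite divff ?rpred1 // pnatr_eq0 -lt0n degree_gt0.
Qed.

Lemma rel_hit_ratio_bounds : 1 / 4 <= rel_hit_ratio R G <= 2.
Proof.
have [x0 _] : exists x0 : G, true by case/card_gt0P: G_conn.1 => x _; exists x.
have d_bound : (0 < degree x0 <= #|vertex G|)%N by rewrite degree_gt0 max_card.
rewrite /rel_hit_ratio (maximal_hitting_timeE srw_ge0 srw_sum srw_sym srw_connect) /=.
have t_ge1 := max_hit_ge1 srw_ge0 srw_sum srw_sym srw_connect G_gt1.
have t_gt0 : 0 < max_hit q by move: t_ge1; rewrite -/q; lra.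
rewrite ler_pdivlMr // ler_pdivrMr //; apply/andP; split.
  have := max_hit_le_relaxation_time srw_ge0 srw_sum srw_sym srw_connect
    srw_trans d_bound (degree_srw_int x0) G_gt1.
  by rewrite -/q; lra.
exact: (relaxation_time_le srw_ge0 srw_sum srw_sym srw_connect
    srw_trans d_bound (degree_srw_int x0) G_gt1).
Qed.

End SimpleRandomWalk.

(** Both bounds come from ln (1 + x) <= x, at x = 1 and at x = -1/2. *)
Lemma ln2_bounds (R : realType) : 1 / 2 <= ln (2 : R) <= 1.
Proof.
have ln2_le : ln 2 <= 1 :> R by apply: (le_ln1Dx (x := 1)); lra.
rewrite ln2_le andbT; have : ln (1 + - (1 / 2)) <= - (1 / 2) :> R.
  by apply: le_ln1Dx; lra.
have -> : 1 + - (1 / 2) = 2^-1 :> R by field.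
by rewrite lnV ?posrE //; lra.
Qed.

Theorem theorem1p2 (R : realType) (G : nat -> graph)
  (Gconn : forall n, graph_connected (G n))
  (Gtrans : forall n, vertex_transitive (G n))
  (Gaper : forall n, aperiodic (@srw R (G n)))
  (Glarge : (fun n => #|vertex (G n)|) @ \oo --> \oo) :
  exists2 eps : nat -> R,
    eps @ \oo --> (0 : R) &
    forall n : nat, (1 < #|vertex (G n)|)%N ->
      1 / (8 * ln 2) <= rel_hit_ratio R (G n) <= 2 / ln 2 + eps n.
Proof.
exists (fun=> 0) => [|n Gn_gt1]; first exact: cvg_cst.
have /andP[ratio_ge ratio_le] := rel_hit_ratio_bounds R (Gconn n) (Gtrans n) Gn_gt1.
have /andP[ln2_ge ln2_le] := ln2_bounds R.
have ln2_gt0 : 0 < ln 2 :> R by lra.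
apply/andP; split.
  apply: le_trans ratio_ge; rewrite ler_pdivrMr; lra.
rewrite addr0; apply: le_trans ratio_le _.
by rewrite ler_pdivlMr //; lra.
Qed.
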